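(* Let $m,n,k\in\mathbb{N}$, $m\ge1$. For all $f,g\in\Pi_{m,n}$, with evaluation vectors $\mathfrak{f}=(f(p_\alpha))_{\alpha\in A_{m,n}}$, $\mathfrak{g}=(g(p_\alpha))_{\alpha\in A_{m,n}}$ and dual distributions $F=\langle f,\cdot\rangle_{L^2(\Omega)}$, $G=\langle g,\cdot\rangle_{L^2(\Omega)}$, the following Sobolev cubature formulas for the truncated (dual) inner products are exact: $$\langle f,g\rangle_{H^k(\Omega)}:=\sum_{\|\beta\|_1\le k}\langle D_\beta f,D_\beta g\rangle_{L^2(\Omega)}=\mathfrak{f}^{T}\,\mathbb{W}_{m,n,k}\,\mathfrak{g},$$ $$\langle f,g\rangle_{H^k(\Omega),*}:=\sum_{\|\beta\|_1\le k}\langle D_\beta^* f,D_\beta^* g\rangle_{L^2(\Omega)}=\mathfrak{f}^{T}\,\underline{\mathbb{W}}_{m,n,k}\,\mathfrak{g},$$ $$\langle F,G\rangle_{H^{-k}(\Omega)}:=\sum_{\|\beta\|_1\le k}\langle D_\beta J^*f,D_\beta J^*g\rangle_{L^2(\Omega)}=\mathfrak{f}^{T}\,\mathbb{W}_{m,n,-k}\,\mathfrak{g},$$ $$\langle F,G\rangle_{H^{-k}(\Omega),*}:=\sum_{\|\beta\|_1\le k}\langle D_\beta^* \underline{J}^*f,D_\beta^* \underline{J}^*g\rangle_{L^2(\Omega)}=\mathfrak{f}^{T}\,\underline{\mathbb{W}}_{m,n,-k}\,\mathfrak{g},$$ where all sums run over $\beta\in\mathbb{N}^m$ with $\|\beta\|_1\le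 k$.
   Context: $\Omega=(-1,1)^m$; $\mathbb{N}$ contains $0$; $\|\beta\|_1=\sum_i\beta_i$. $A_{m,n}=\{\alpha\in\mathbb{N}^m:\max_i\alpha_i\le n\}$, and $\Pi_{m,n}=\mathrm{span}\{x^\alpha:\alpha\in A_{m,n}\}$ is the space of real polynomials in $m$ variables of maximum degree $n$, regarded as functions on $\Omega$. Legendre grid: $p_0,\dots,p_n$ are the $n+1$ roots of the univariate Legendre polynomial of degree $n+1$; $p_\alpha=(p_{\alpha_1},\dots,p_{\alpha_m})$ for $\alpha\in A_{m,n}$. Lagrange polynomials: $L_\alpha(x)=\prod_{i=1}^m\prod_{0\le j\le n,\,j\ne\alpha_i}\frac{x_i-p_j}{p_{\alpha_i}-p_j}$, so $L_\alpha(p_\beta)=\delta_{\alpha,\beta}$. Weights: $w_\alpha=\|L_\alpha\|_{L^2(\Omega)}^2$, and $\mathbb{W}_{m,n}=\mathrm{diag}(w_\alpha)_{\alpha\in A_{m,n}}$. A polynomial $Q\in\Pi_{m,n}$ is identified with its evaluation vector $(Q(p_\alpha))_{\alpha\in A_{m,n}}$ (its Lagrange coefficients). $D_\beta=\partial_{x_1}^{\beta_1}\cdots\partial_{x_m}^{\beta_m}:\Pi_{m,n}\to\Pi_{m,n}$, and $\mathbb{D}_\beta\in\mathbb{R}^{|A_{m,n}|\times|A_{m,n}|}$ is the matrix representing it on (column) evaluation vectors: $\mathbb{D}_\beta=\prod_{i=1}^m D_i^{\beta_i}$ with $(D_i)_{\alpha,\gamma}=\partial_{x_i}L_\gamma(p_\alpha)$.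 The truncated adjoint $D_\beta^*:\Pi_{m,n}\to\Pi_{m,n}$ is the linear operator with $\langle D_\beta Q_1,Q_2\rangle_{L^2(\Omega)}=\langle Q_1,D_\beta^*Q_2\rangle_{L^2(\Omega)}$ for all $Q_1,Q_2\in\Pi_{m,n}$; its matrix is $\mathbb{D}_\beta^*=\mathbb{W}_{m,n}^{-1}\mathbb{D}_\beta^{T}\mathbb{W}_{m,n}$. Set $$\mathbb{J}^*=\Big(\sum_{\|\beta\|_1\le k}\mathbb{D}_\beta^*\mathbb{D}_\beta\Big)^{-1},\qquad \underline{\mathbb{J}}^*=\Big(\sum_{\|\beta\|_1\le k}\mathbb{D}_\beta\mathbb{D}_\beta^*\Big)^{-1},$$ and let $J^*,\underline{J}^*:\Pi_{m,n}\to\Pi_{m,n}$ be the linear operators represented on evaluation vectors by $\mathbb{J}^*,\underline{\mathbb{J}}^*$. The Sobolev cubature matrices are $$\mathbb{W}_{m,n,k}=\mathbb{W}_{m,n}(\mathbb{J}^{*})^{-1},\quad \mathbb{W}_{m,n,-k}=\mathbb{W}_{m,n}\mathbb{J}^*,\quad \underline{\mathbb{W}}_{m,n,k}=\mathbb{W}_{m,n}(\underline{\mathbb{J}}^{*})^{-1},\quad \underline{\mathbb{W}}_{m,n,-k}=\mathbb{W}_{m,n}\underline{\mathbb{J}}^*.$$ The symbols $\langle F,G\rangle_{H^{-k}(\Omega)}$ and $\langle F,G\rangle_{H^{-k}(\Omega),*}$ here denote the truncated inner products defined by the sums in the claim. *)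

(* Defs.v *)
From HB Require Import structures.
From mathcomp Require Import all_boot all_order all_algebra.
(* The notations of mpoly clash with those of mathcomp-analysis. Its names also
   do (isMeasure), hence it must be imported first. *)
From mathcomp Require Import -(notations) mpoly.
From mathcomp Require Import all_classical all_reals all_analysis.

Set Implicit Arguments.
Unset Strict Implicit.
Unset Printing Implicit Defensive.

Import Order.TTheory GRing.Theory Num.Theory.
Import numFieldNormedType.Exports.

Local Open Scope classical_set_scope.
Local Open Scope ring_scope.

Section LebesgueTuple.
Variable R : realType.
Local Notation RT := (measurableTypeR R).

Definition cons_pair m (z : RT * m.-tuple RT) : m.+1.-tuple RT :=
  [tuple of z.1 :: z.2].

Lemma measurable_cons_pair m : measurable_fun [set: RT * m.-tuple RT] (@cons_pair m).
Proof. exact: (measurable_cons measurable_fst measurable_snd). Qed.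

Section cons.
Variables (m : nat) (mu : {sigma_finite_measure set (m.-tuple RT) -> \bar R}).

Definition lebesgue_cons : set (m.+1.-tuple RT) -> \bar R :=
  pushforward (lebesgue_measure \x mu)%E (@cons_pair m).

HB.instance Definition _ :=
  isMeasurableFun.Build _ _ _ _ (@cons_pair m) (@measurable_cons_pair m).

Let lebesgue_cons0 : lebesgue_cons set0 = 0%E.
Proof. exact: measure0. Qed.

Let lebesgue_cons_ge0 A : (0 <= lebesgue_cons A)%E.
Proof. exact: measure_ge0. Qed.

Let lebesgue_cons_sigma_additive : semi_sigma_additive lebesgue_cons.
Proof. exact: measure_semi_sigma_additive. Qed.

HB.instance Definition _ := isMeasure.Build _ _ _ lebesgue_cons
  lebesgue_cons0 lebesgue_cons_ge0 lebesgue_cons_sigma_additive.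

Let lebesgue_cons_sigma_finite : sigma_finite setT lebesgue_cons.
Proof.
(* The library's sigma-finite instance on \x is found only for subprobabilities. *)
have [F FT mF] : sigma_finite setT (lebesgue_measure \x mu)%E.
  have /sigma_finiteP[F [TF ndF Foo]] := sigma_finiteT (@lebesgue_measure R).
  have /sigma_finiteP[G [TG ndG Goo]] := sigma_finiteT mu.
  exists (fun i => F i `*` G i) => [|i].
    rewrite -setXTT TF TG; apply/seteqP; split=> -[x y]; last first.
      by move=> [i _ [/= Fx Gy]]; split; exists i.
    move=> [/= [i _ Fx] [j _ Gy]]; exists (maxn i j) => //; split.
    - by move: x Fx; exact/subsetPset/ndF/leq_maxl.
    - by move: y Gy; exact/subsetPset/ndG/leq_maxr.
  have [mF Fi] := Foo i; have [mG Gi] := Goo i; split; first exact: measurableX.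
  by rewrite product_measure1E// lte_mul_pinfty// ge0_fin_numE.
pose u (t : m.+1.-tuple RT) : RT * m.-tuple RT := (thead t, [tuple of behead t]).
have mu_ : measurable_fun setT u.
  by apply/measurable_fun_pairP; split; [exact: measurable_tnth|exact: measurable_behead].
have uK : cancel (@cons_pair m) u.
  by move=> [x t]; rewrite /u /thead tnth0; congr pair; apply/val_inj.
exists (fun i => u @^-1` F i) => [|i]; first by rewrite -preimage_bigcup -FT.
have [mFi Fioo] := mF i; split; first by rewrite -[X in measurable X]setTI; exact: mu_.
suff -> : lebesgue_cons (u @^-1` F i) = (lebesgue_measure \x mu)%E (F i) by [].
by rewrite /lebesgue_cons /pushforward -comp_preimage; congr (_ _); apply/seteqP; split=> z /=;
  rewrite uK.
Qed.

HB.instance Definition _ := Measure_isSigmaFinite.Build _ _ _ lebesgue_cons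
  lebesgue_cons_sigma_finite.

End cons.

(* Lebesgue measure on R^m, the product of m copies of the one on R. *)
Fixpoint lebesgue_tuple m : {sigma_finite_measure set (m.-tuple RT) -> \bar R} :=
  if m is m'.+1 then lebesgue_cons (lebesgue_tuple m')
  else dirac ([tuple] : 0.-tuple RT).

End LebesgueTuple.

Local Notation "{ 'mpoly' T [ n ] }" := (mpoly n T).
Local Notation "p @_ M" := (mcoeff M p) (at level 3, M at level 2).

Section MaxDegree.
Variables (R : realType) (m : nat).
Implicit Types (p q : {mpoly R[m]}) (d e : 'I_m -> nat).

(* d bounds the degree separately in each variable. *)
Definition deg_le d : {pred {mpoly R[m]}} :=
  fun p => all (fun M : multinom m => [forall i, M i <= d i]%N) (msupp p).

Lemma deg_leP d p :
  reflect (forall (M : multinom m) i, p@_M != 0 -> (M i <= d i)%N) (p \in deg_le d).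
Proof.
rewrite unfold_in; apply: (iffP allP) => [dp M i pM|dp M].
  by have /forallP/(_ i) := dp M (etrans (mcoeff_msupp p M) pM).
by rewrite mcoeff_msupp => pM; apply/forallP => i; exact: dp.
Qed.

Lemma deg_le_submod d : submod_closed (deg_le d).
Proof.
split=> [|c p q /deg_leP dp /deg_leP dq]; apply/deg_leP => M i.
  by rewrite mcoeff0 eqxx.
rewrite mcoeffD mcoeffZ.
have [->|/dp//] := eqVneq (p@_M) 0; rewrite mulr0 add0r; exact: dq.
Qed.

HB.instance Definition _ d :=
  GRing.isSubmodClosed.Build R {mpoly R[m]} (deg_le d) (deg_le_submod d).

Lemma deg_leW d e p : (forall i, d i <= e i)%N -> p \in deg_le d -> p \in deg_le e.
Proof. by move=> de /deg_leP dp; apply/deg_leP => M i /dp/leq_trans; apply. Qed.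

Lemma deg_leM d e p q :
  p \in deg_le d -> q \in deg_le e -> p * q \in deg_le (fun i => d i + e i)%N.
Proof.
move=> /deg_leP dp /deg_leP eq; apply/deg_leP => M i; rewrite mcoeffM.
apply: contraR; rewrite -ltnNge => ltM; apply/eqP/big1 => -[[k1 ?] [k2 ?]] /= /eqP ME.
have [->|/dp d1] := eqVneq (p@_k1) 0; first by rewrite mul0r.
have [->|/eq e2] := eqVneq (q@_k2) 0; first by rewrite mulr0.
by move: ltM; rewrite {}ME mnmDE ltnNge leq_add.
Qed.

Lemma deg_le_prod (I : Type) (r : seq I) (P : pred I) (D : I -> 'I_m -> nat)
    (F : I -> {mpoly R[m]}) :
  (forall x, P x -> F x \in deg_le (D x)) ->
  \prod_(x <- r | P x) F x \in deg_le (fun i => \sum_(x <- r | P x) D x i)%N.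
Proof.
move=> FD; elim: r => [|x r IHr].
  rewrite big_nil; apply/deg_leP => M i; rewrite mcoeff1.
  by case: (eqVneq M mnm0) => [->|_]; rewrite ?mnm0E ?eqxx.
rewrite big_cons; case: ifPn => Px.
  by apply: deg_leW (deg_leM (FD x Px) IHr) => i; rewrite big_cons Px.
by apply: deg_leW IHr => i; rewrite big_cons (negPf Px).
Qed.

Lemma deg_le_linear (i : 'I_m) (c : R) :
  mpolyX R (mnm1 i) - mpolyC m c \in deg_le (fun j => i == j).
Proof.
apply/deg_leP => M j; rewrite mcoeffB mcoeffX mcoeffC.
case: (eqVneq (mnm1 i) M) => [<- _|_]; first by rewrite mnm1E.
by case: (eqVneq M mnm0) => [->|_]; rewrite ?mnm0E // mulr0 subrr eqxx.
Qed.

Lemma deg_le_deriv d (i : 'I_m) p : p \in deg_le d -> mderiv i p \in deg_le d.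
Proof.
move=> /deg_leP dp; apply/deg_leP => M j; rewrite mcoeff_deriv.
have [->|pM _] := eqVneq (p@_(mnm_add M (mnm1 i))) 0.
  by rewrite mul0rn eqxx.
by apply: leq_trans (dp _ j pM); rewrite mnmDE leq_addr.
Qed.

Lemma deg_le_derivm d (b : multinom m) p : p \in deg_le d -> mderivm b p \in deg_le d.
Proof.
move=> dp; rewrite /mderivm; elim: (enum _) => //= i s IHs.
by elim: (b i) => //= k IHk; exact: deg_le_deriv.
Qed.

End MaxDegree.

Section Legendre.
Variable R : realType.

(* Rodrigues' formula *)
Definition legendre N : {poly R} :=
  (2 ^+ N * N`!%:R)^-1 *: (('X^2 - 1) ^+ N)^`(N).

(* An injective listing of roots of a polynomial of degree n + 1 by n + 1
   indices lists all of them; no ordering of the roots is imposed. *)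
Definition legendre_grid n (p : 'I_n.+1 -> R) : Prop :=
  injective p /\ forall i, root (legendre n.+1) (p i).

End Legendre.

Section L2.
Variables (R : realType) (m : nat).

Definition cube : set (m.-tuple (measurableTypeR R)) :=
  [set x | forall i, -1 < (tnth x i : R) < 1].

Definition L2ip (u v : m.-tuple (measurableTypeR R) -> R) : R :=
  \int[lebesgue_tuple R m]_(x in cube) (u x * v x).

End L2.

Section Cubature.
Variables (R : realType) (m n : nat).

(* The space Pi_{m,n} of polynomials of maximum degree at most n. *)
Record maxpoly := MaxPoly {
  maxpoly_val :> {mpoly R[m]};
  _ : maxpoly_val \in deg_le (fun=> n) }.

HB.instance Definition _ := [isSub for maxpoly_val].
HB.instance Definition _ := [Choice of maxpoly by <:].
HB.instance Definition _ := [SubChoice_isSubLmodule of maxpoly by <:].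

Definition maxpoly_fun (Q : maxpoly) : m.-tuple (measurableTypeR R) -> R :=
  fun x => meval (tnth x) Q.

Definition ip (Q1 Q2 : maxpoly) : R := L2ip (maxpoly_fun Q1) (maxpoly_fun Q2).

Definition D_op (b : multinom m) (Q : maxpoly) : maxpoly :=
  MaxPoly (deg_le_derivm b (valP Q)).

Definition is_adjoint (T S : maxpoly -> maxpoly) : Prop :=
  linear S /\ forall Q1 Q2, ip (T Q1) Q2 = ip Q1 (S Q2).

(* The adjoint within Pi_{m,n}; the zero map is only a default value for a map
   that has no adjoint. *)
Definition adjoint (T : maxpoly -> maxpoly) : maxpoly -> maxpoly :=
  match pselect (exists S, is_adjoint T S) with
  | left h => projT1 (cid h)
  | right _ => fun=> 0
  end.

Definition Dstar_op (b : multinom m) : maxpoly -> maxpoly := adjoint (D_op b).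

(* The multi-indices A_{m,n}; matrices over A_{m,n} are indexed through the
   enumeration of this finite type. *)
Local Notation A := {ffun 'I_m -> 'I_n.+1}.

Variable p : 'I_n.+1 -> R.

Definition node (a : A) : 'I_m -> R := fun i => p (a i).

Definition lagrange_mpoly (a : A) : {mpoly R[m]} :=
  \prod_(i < m) \prod_(j < n.+1 | j != a i)
    ((p (a i) - p j)^-1 *: (mpolyX R (mnm1 i) - mpolyC m (p j))).

Lemma lagrange_deg a : lagrange_mpoly a \in deg_le (fun=> n).
Proof.
pose d (i j : 'I_m) := (\sum_(l < n.+1 | l != a i) (i == j))%N.
apply: (@deg_leW _ _ (fun j => \sum_i d i j)%N) => [j|].
  rewrite (bigD1 j)//= big1 ?addn0 => [|i /negPf ij]; last first.
    by rewrite /d ij big1.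
  rewrite /d eqxx (eq_bigr (fun=> 1%N))// sum1_card.
  by rewrite (eq_card (_ : _ =i predC1 (a j)))// cardC1 card_ord.
apply: deg_le_prod => i _; apply: deg_le_prod => j _.
exact/rpredZ/deg_le_linear.
Qed.

Definition lagrange (a : A) : maxpoly := MaxPoly (lagrange_deg a).

Definition evalvec (Q : maxpoly) : 'cV[R]_#|A| :=
  \col_a meval (node (enum_val a)) Q.

(* The operator on Pi_{m,n} represented on evaluation vectors by M. *)
Definition mx_op (M : 'M[R]_#|A|) (Q : maxpoly) : maxpoly :=
  \sum_a (M *m evalvec Q) a 0 *: lagrange (enum_val a).

Definition W_mx : 'M[R]_#|A| :=
  diag_mx (\row_a ip (lagrange (enum_val a)) (lagrange (enum_val a))).

Definition D1_mx (i : 'I_m) : 'M[R]_#|A| :=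
  \matrix_(a, c) meval (node (enum_val a)) (mderiv i (lagrange (enum_val c))).

Definition D_mx (b : multinom m) : 'M[R]_#|A| := \prod_(i < m) D1_mx i ^+ b i.

Definition Dstar_mx (b : multinom m) : 'M[R]_#|A| :=
  invmx W_mx *m (D_mx b)^T *m W_mx.

(* A bounded multinomial b : bmultinom m k.+1 is a multi-index with mdeg b < k.+1,
   that is, of 1-norm at most k. *)
Variable k : nat.

Definition J_mx : 'M[R]_#|A| :=
  invmx (\sum_(b : bmultinom m k.+1) Dstar_mx b *m D_mx b).

Definition Junder_mx : 'M[R]_#|A| :=
  invmx (\sum_(b : bmultinom m k.+1) D_mx b *m Dstar_mx b).

Definition J_op : maxpoly -> maxpoly := mx_op J_mx.
Definition Junder_op : maxpoly -> maxpoly := mx_op Junder_mx.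

Definition W_pos : 'M[R]_#|A| := W_mx *m invmx J_mx.
Definition W_neg : 'M[R]_#|A| := W_mx *m J_mx.
Definition Wunder_pos : 'M[R]_#|A| := W_mx *m invmx Junder_mx.
Definition Wunder_neg : 'M[R]_#|A| := W_mx *m Junder_mx.

Definition sobolev_ip (f g : maxpoly) : R :=
  \sum_(b : bmultinom m k.+1) ip (D_op b f) (D_op b g).

Definition sobolev_star_ip (f g : maxpoly) : R :=
  \sum_(b : bmultinom m k.+1) ip (Dstar_op b f) (Dstar_op b g).

Definition functional := (m.-tuple (measurableTypeR R) -> R) -> R.

Definition dual (f : maxpoly) : functional := fun h => L2ip (maxpoly_fun f) h.

(* The inner products of negative order act on functionals F = dual f, through f. *)
Definition representer (F : functional) : maxpoly :=
  xget 0 [set f | F = dual f].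

Definition neg_sobolev_ip (F G : functional) : R :=
  \sum_(b : bmultinom m k.+1)
    ip (D_op b (J_op (representer F))) (D_op b (J_op (representer G))).

Definition neg_sobolev_star_ip (F G : functional) : R :=
  \sum_(b : bmultinom m k.+1)
    ip (Dstar_op b (Junder_op (representer F)))
       (Dstar_op b (Junder_op (representer G))).

End Cubature.

(* Main.v *)
(* The product of two distinct univariate Lagrange polynomials vanishes at all
   Gauss nodes, so it is a multiple of the Legendre polynomial with a cofactor
   of degree < n and has integral 0 over ]-1, 1[ (Rodrigues' formula and repeated
   integration by parts). By Fubini the multivariate Lagrange basis is therefore
   orthogonal, so that in evaluation vectors the L2 inner product is given by
   the diagonal positive matrix W. Each operator is then the multiplication by its
   matrix; the sums of the D*_b D_b and of the D_b D*_b are invertible since, up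
   to a factor W or W^-1, they are sums of Gram matrices whose term at b = 0 is
   positive definite. *)

Require Import Defs.
From HB Require Import structures.
From mathcomp Require Import all_boot all_order all_algebra.
From mathcomp Require Import -(notations) mpoly.
From mathcomp Require Import ring.
From mathcomp Require Import all_classical all_reals all_analysis measurable_realfun.

Import Order.TTheory GRing.Theory Num.Theory.
Import numFieldNormedType.Exports.

Set Implicit Arguments.
Unset Strict Implicit.
Unset Printing Implicit Defensive.

Local Open Scope classical_set_scope.
Local Open Scope ring_scope.

(** * Tensor products and Lebesgue measure *)

Section TensorIntegral.
Variable R : realType.
Local Notation RT := (measurableTypeR R).
Local Notation mu := (@lebesgue_measure R).

Lemma measurable_tensor m (v : 'I_m -> RT -> R) :
  (forall i, measurable_fun setT (v i)) ->
  measurable_fun setT (fun x : m.-tuple RT => \prod_i v i (tnth x i)).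
Proof.
move=> mv; apply: measurable_prod => i _.
by apply: measurableT_comp => //; exact: measurable_tnth.
Qed.

(** Induction on [m], transporting the integral along [cons_pair] and applying Fubini. Integrability
    and value are proved together, since Fubini needs the former for the tail before the latter can
    be used. *)
Lemma integral_tensor m (v : 'I_m -> RT -> R) :
  (forall i, mu.-integrable setT (EFin \o v i)) ->
  (lebesgue_tuple R m).-integrable setT
    (fun x => (\prod_i v i (tnth x i))%:E) /\
  (\int[lebesgue_tuple R m]_x (\prod_i v i (tnth x i))%:E =
   (\prod_i \int[mu]_x v i x)%:E)%E.
Proof.
elim: m v => [|m IHm] v iv.
  have fE : (fun x : 0.-tuple RT => (\prod_i v i (tnth x i))%:E) = cst 1%E.
    by apply/funext => x; rewrite big_ord0.
  rewrite fE big_ord0; split; last by rewrite integral_cst//= diracT mule1.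
  apply/integrableP; split => //=.
  by rewrite normr1 integral_cst//= diracT mule1 ltry.
have mv i : measurable_fun setT (v i).
  by apply/measurable_EFinP; exact: measurable_int (iv i).
have [IHi IHe] := IHm _ (fun i => iv (lift ord0 i)).
set u := fun x : m.-tuple RT => _ in IHi.
pose h (z : RT * m.-tuple RT) := ((v ord0 z.1)%:E * u z.2)%E.
set f := fun x : m.+1.-tuple RT => (_)%:E.
have fh : f \o @cons_pair R m = h.
  apply/funext => -[x t]; rewrite /f /h /u /= big_ord_recl tnth0 EFinM.
  by congr (_ * _)%E; congr EFin; apply: eq_bigr => i _; rewrite tnthS.
have mf : measurable_fun setT f by apply/measurable_EFinP; exact: measurable_tensor.
have mh : measurable_fun setT h.
  by rewrite -fh; apply: measurableT_comp => //; exact: measurable_cons_pair.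
(* By Tonelli it is enough that the iterated integral of the absolute value is finite; it factors
   into two finite integrals. *)
have ih : (mu \x lebesgue_tuple R m)%E.-integrable setT h.
  apply/integrable12ltyP => //.
  have hE x : (\int[lebesgue_tuple R m]_y `|h (x, y)| =
      `|(v ord0 x)%:E| * \int[lebesgue_tuple R m]_y `|u y|)%E.
    rewrite -ge0_integralZl//.
      by apply: eq_integral => y _; rewrite /h abseM.
    by apply: measurableT_comp => //; exact: measurable_int IHi.
  under eq_integral do rewrite hE.
  rewrite ge0_integralZr//.
  - apply: lte_mul_pinfty; first exact: integral_ge0.
      by rewrite ge0_fin_numE ?integral_ge0//; case/integrableP: (iv ord0).
    by case/integrableP: IHi.
  - by apply: measurableT_comp => //; apply/measurable_EFinP.
  - exact: integral_ge0.
have ihf : (mu \x lebesgue_tuple R m)%E.-integrable (@cons_pair R m @^-1` setT)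
    (f \o @cons_pair R m) by rewrite fh preimage_setT.
split.
  exact: (integrable_pushforward (@measurable_cons_pair R m) mf ihf).
rewrite [LHS](integral_pushforward (@measurable_cons_pair R m) mf ihf)//.
rewrite fh preimage_setT -integral12_prod_meas1//= /fubini_F /h /=.
under eq_integral => x _ do rewrite integralZl// IHe.
rewrite integralZr//; last exact: (iv ord0).
rewrite big_ord_recl EFinM; congr (_ * _)%E.
by rewrite fineK//; exact: integrable_fin_num (iv ord0).
Qed.

End TensorIntegral.

(** * Gauss quadrature in one variable *)

Section UnivariateIntegral.
Variable R : realType.
Local Notation mu := (@lebesgue_measure R).
Implicit Types q r : {poly R}.

Definition poly_integral q : R := \int[mu]_(x in `]-1, 1[) q.[x].

Lemma integrable_poly q : mu.-integrable `]-1, 1[ (EFin \o horner q).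
Proof.
have : mu.-integrable `[-1, 1] (EFin \o horner q); last first.
  by apply: integrableS => //; exact: subset_itv_oo_cc.
apply: continuous_compact_integrable; first exact: segment_compact.
by apply: continuous_subspaceT => x; exact: continuous_horner.
Qed.

Lemma poly_integralD q r :
  poly_integral (q + r) = poly_integral q + poly_integral r.
Proof.
rewrite /poly_integral -RintegralD//; [|exact: integrable_poly..].
by apply: eq_Rintegral => x _; rewrite hornerD.
Qed.

Lemma poly_integralZ c q : poly_integral (c *: q) = c * poly_integral q.
Proof.
rewrite /poly_integral -RintegralZl//; last exact: integrable_poly.
by apply: eq_Rintegral => x _; rewrite hornerZ.
Qed.

Lemma poly_integral_deriv q : poly_integral q^`() = q.[1] - q.[-1].
Proof.
(* The endpoints are null, so the integral is moved to the closed interval, where the fundamental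
   theorem of calculus applies. *)
rewrite /poly_integral /Rintegral -(@integral_itv_bndoo R _ _ _ true false); last first.
  by apply/measurable_EFinP; exact: measurable_poly.
rewrite (@continuous_FTC2 _ _ (horner q)) -?EFinB//.
- by apply: continuous_subspaceT => x; exact: continuous_horner.
- split=> [x _||]; first exact: derivable_horner.
  + by apply: cvg_at_right_filter; exact: continuous_horner.
  + by apply: cvg_at_left_filter; exact: continuous_horner.
- by move=> x _; rewrite derivE.
Qed.

Lemma poly_integral_by_parts q r :
  poly_integral (q^`() * r) =
  (q * r).[1] - (q * r).[-1] - poly_integral (q * r^`()).
Proof.
by rewrite -poly_integral_deriv derivM poly_integralD addrK.
Qed.

Lemma finite_roots q : q != 0 -> finite_set [set x | root q x].
Proof.
have [N] := ubnP (size q); elim: N q => // N IHN q; rewrite ltnS => sq q0.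
have [[x qx]|noroot] := pselect (exists x, root q x); last first.
  by rewrite (_ : mkset _ = set0)// -subset0 => x qx; apply: noroot; exists x.
have /factor_theorem[r qE] := qx.
have r0 : r != 0 by apply: contraNneq q0 => r0; rewrite qE r0 mul0r.
apply: (@sub_finite_set _ _ ([set x] `|` [set y | root r y])).
  move=> y /=; rewrite qE rootM root_XsubC => /orP[ry|/eqP->]; by [right|left].
rewrite finite_setU; split=> //; apply: IHN => //.
by move: sq; rewrite qE size_Mmonic ?monicXsubC// size_XsubC addn2.
Qed.

(** If the integral were 0, then [q] would vanish almost everywhere on ]-1, 1[. The interval would
    be covered by a null set and the finitely many roots of [q], although its measure is 2. *)
Lemma poly_integral_sqr_gt0 q : q != 0 -> 0 < poly_integral (q ^+ 2).
Proof.
move=> q0; rewrite lt_neqAle Rintegral_ge0 => [|x _]; last first.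
  by rewrite horner_exp sqr_ge0.
rewrite andbT eq_sym; apply/eqP => q20.
have mq2 : measurable_fun (`]-1, 1[%classic : set R) (EFin \o horner (q ^+ 2)).
  by apply/measurable_EFinP; exact: measurable_poly.
have /(ae_eq_integral_abs mu (measurable_itv _)) :
    (\int[mu]_(x in `](-1)%R, 1%R[) `|(EFin \o horner (q ^+ 2)) x| = 0)%E.
  under eq_integral => x _ do
    rewrite /= ger0_norm ?horner_exp ?sqr_ge0// -horner_exp.
  by rewrite -[RHS]/(0%:E) -q20 fineK//; exact: integrable_fin_num (integrable_poly _).
move=> /(_ mq2) [A [mA A0 qA]].
have n11 : mu.-negligible (`]-1, 1[%classic : set R).
  have : mu.-negligible (A `|` [set x | root q x]); last first.
    apply: negligibleS => x x11.
    have [rx|rx] := boolP (root q x); [by right|left].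
    apply: qA => /= /(_ x11) []; rewrite horner_exp => /eqP.
    by rewrite expf_eq0/= -rootE (negPf rx).
  have nA : mu.-negligible A by exists A; split.
  apply: (negligibleU nA).
  have cq := finite_set_countable (finite_roots q0).
  exists [set x | root q x]; split=> //; last exact: countable_lebesgue_measure0.
  exact: countable_measurable.
have : mu `]-1, 1[ = 0%E by exact: measure_negligible n11.
rewrite lebesgue_measure_itv/= lte_fin gtrN// => /eqP.
by rewrite eqe opprK gt_eqF// addr_gt0.
Qed.

End UnivariateIntegral.

(** * Orthogonality of Legendre polynomials to lower degrees *)

Section LegendreOrthogonality.
Variable R : realType.
Implicit Types q r : {poly R}.

(** Each derivative costs at most one factor [u]. With [u] equal to X^2 - 1, this kills the boundary
    terms in the integrations by parts. *)
Lemma derivn_exp_factor (u : {poly R}) N j :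
  exists r, (u ^+ (j + N))^`(j) = u ^+ N * r.
Proof.
elim: j N => [|j IHj] N; first by exists 1; rewrite mulr1.
have [r] := IHj N.+1; rewrite addnS -addSn => rE.
exists (u^`() * r *+ N.+1 + u * r^`()).
rewrite derivnS rE derivM deriv_exp /= mulrDr exprSr.
congr (_ + _); last by rewrite mulrA.
by rewrite mulrnAl mulrnAr mulrAC [in RHS]mulrC.
Qed.

(** Each integration by parts moves one derivative onto [q] and lowers its size, so [q] is exhausted
    after at most [j] of them. *)
Lemma integral_derivn_X2sub1 N j q : (j <= N)%N -> (size q <= j)%N ->
  poly_integral ((('X^2 - 1) ^+ N)^`(j) * q) = 0.
Proof.
elim: j q => [|j IHj] q jN; rewrite ?leqn0 ?size_poly_eq0.
  by move=> /eqP->; rewrite mulr0 -deriv0 poly_integral_deriv !horner0 subrr.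
move=> sq; rewrite derivnS poly_integral_by_parts IHj ?(ltnW jN)//; last first.
  have [->|q0] := eqVneq q 0; first by rewrite deriv0 size_poly0.
  by rewrite -ltnS (leq_trans _ sq)// lt_size_deriv.
(* Here j < N, so the j-th derivative keeps a positive power of X^2 - 1 and both boundary terms are
   0. *)
have [r rE] := derivn_exp_factor ('X^2 - 1) (N - j).-1.+1 j.
rewrite prednK ?subn_gt0// subnKC ?(ltnW jN)// in rE.
rewrite rE !(hornerM, horner_exp) !hornerE.
by rewrite expr1n sqrrN expr1n subrr expr0n subn_eq0 leqNgt jN !mul0r !subrr.
Qed.

Lemma integral_legendre N q : (size q <= N)%N ->
  poly_integral (legendre R N * q) = 0.
Proof.
by move=> sq; rewrite -scalerAl poly_integralZ integral_derivn_X2sub1 ?mulr0.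
Qed.

(** The coefficient of degree [N] comes from the leading term X^(2N), which [N] derivatives multiply
    by a nonzero falling factorial. *)
Lemma size_legendre N : size (legendre R N) = N.+1.
Proof.
have u1 : ('X^2 - 1 : {poly R}) \is monic by rewrite monicXnsubC.
have su : size (('X^2 - 1 : {poly R}) ^+ N) = (N + N).+1.
  rewrite -(prednK (_ : 0 < size _)%N) ?size_exp ?size_XnsubC//= ?mul2n ?addnn//.
  by rewrite size_poly_gt0 expf_neq0// monic_neq0.
rewrite size_scale; last first.
  by rewrite invr_neq0// mulf_neq0 ?expf_neq0 ?pnatr_eq0 -?lt0n ?fact_gt0.
apply/eqP; rewrite eqn_leq; apply/andP; split.
  apply/leq_sizeP => j Nj; rewrite coef_derivn nth_default ?mul0rn//.
  by rewrite su ltn_add2l.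
rewrite ltnNge; apply/negP => /leq_sizeP/(_ _ (leqnn _)).
rewrite coef_derivn -[X in _`_X]/((N + N).+1.-1) -su -lead_coefE.
rewrite (monicP (monic_exp N u1)) => /eqP.
by rewrite pnatr_eq0 eqn0Ngt ffact_gt0 leq_addr.
Qed.

End LegendreOrthogonality.

(** * Univariate Lagrange basis and its orthogonality on the Legendre grid *)

Section UnivariateLagrange.
Variables (R : realType) (n : nat) (p : 'I_n.+1 -> R).
Hypothesis p_inj : injective p.

Definition lagrange1 (i : 'I_n.+1) : {poly R} :=
  \prod_(j < n.+1 | j != i) ((p i - p j)^-1 *: ('X - (p j)%:P)).

Lemma lagrange1E i j : (lagrange1 i).[p j] = (i == j)%:R.
Proof.
rewrite /lagrange1 horner_prod; case: (eqVneq i j) => [<-|ij].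
  apply: big1 => l li; rewrite !hornerE mulVf// subr_eq0 (inj_eq p_inj).
  by rewrite eq_sym.
by rewrite (bigD1 j)/= 1?eq_sym// !hornerE subrr mulr0 mul0r.
Qed.

Lemma lagrange1_neq0 i : lagrange1 i != 0.
Proof.
apply/eqP => /(congr1 (horner^~ (p i))) /eqP.
by rewrite lagrange1E eqxx horner0 oner_eq0.
Qed.

Lemma size_lagrange1 i : (size (lagrange1 i) <= n.+1)%N.
Proof.
apply: leq_trans (size_poly_prod_leq _ _) _.
have cP : #|[pred j | j != i]| = n by rewrite cardC1 card_ord.
have sP : (\sum_(j < n.+1 | j != i) size ((p i - p j)^-1 *: ('X - (p j)%:P)) <=
    \sum_(j < n.+1 | j != i) 2)%N.
  by apply: leq_sum => j _; rewrite (leq_trans (size_scale_leq _ _))// size_XsubC.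
by rewrite cP leq_subLR addnS ltnS (leq_trans sP)// sum_nat_const cP muln2 addnn.
Qed.

(** The difference of the two sides has size at most n + 1 and vanishes at n + 1 distinct nodes. *)
Lemma lagrange1_interpolation (q : {poly R}) : (size q <= n.+1)%N ->
  q = \sum_i q.[p i] *: lagrange1 i.
Proof.
move=> sq; apply/eqP; rewrite -subr_eq0; apply/eqP.
apply: (@roots_geq_poly_eq0 _ _ [seq p i | i <- enum 'I_n.+1]).
- apply/allP => _ /mapP[j _ ->]; rewrite rootE hornerD hornerN horner_sum.
  rewrite (bigD1 j)//= big1 => [|i ij]; rewrite hornerZ lagrange1E.
    by rewrite eqxx mulr1 addr0 subrr.
  by rewrite (negPf ij) mulr0.
- by rewrite map_inj_uniq ?enum_uniq.
- rewrite size_map -cardE card_ord (leq_trans (size_polyD _ _))// geq_max sq.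
  rewrite size_polyN (leq_trans (size_sum _ _ _))//; apply/bigmax_leqP => i _.
  by rewrite (leq_trans (size_scale_leq _ _))// size_lagrange1.
Qed.

End UnivariateLagrange.

Lemma integral_lagrange1M (R : realType) n (p : 'I_n.+1 -> R) i j :
  legendre_grid p -> i != j -> poly_integral (lagrange1 p i * lagrange1 p j) = 0.
Proof.
move=> [p_inj p_root] ij; pose s := [seq p l | l <- enum 'I_n.+1].
have us : uniq_roots s by rewrite uniq_rootsE map_inj_uniq ?enum_uniq.
have ss : size s = n.+1 by rewrite size_map -cardE card_ord.
(* The n + 1 distinct nodes are as many as the degree, so they exhaust the roots. *)
have PE : legendre R n.+1 = lead_coef (legendre R n.+1) *: \prod_(z <- s) ('X - z%:P).
  apply: all_roots_prod_XsubC => //; first by rewrite size_legendre ss.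
  by apply/allP => _ /mapP[l _ ->].
set c := lead_coef _ in PE; set P := \prod_(z <- s) _ in PE.
have c0 : c != 0 by rewrite lead_coef_eq0 -size_poly_gt0 size_legendre.
(* As [i] and [j] differ, at every node one of the two factors is 0. *)
have : P %| lagrange1 p i * lagrange1 p j.
  apply: uniq_roots_dvdp => //; apply/allP => _ /mapP[l _ ->].
  rewrite rootE hornerM !lagrange1E//.
  case: (eqVneq i l) => [<-|_]; last by rewrite mul0r.
  by rewrite [j == i]eq_sym (negPf ij) mulr0.
have sP : size P = n.+2 by rewrite size_prod_XsubC ss.
have P0 : P != 0 by rewrite -size_poly_gt0 sP.
move=> /dvdpP[q qE].
have q0 : q != 0.
  apply/eqP => q0; have := mulf_neq0 (lagrange1_neq0 p_inj i) (lagrange1_neq0 p_inj j).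
  by rewrite qE q0 mul0r eqxx.
rewrite qE mulrC -[P]scale1r -(mulVf c0) -scalerA -PE -scalerAl poly_integralZ.
rewrite integral_legendre ?mulr0//.
have sqP : (size q + n.+2).-1 = size (lagrange1 p i * lagrange1 p j).
  by rewrite qE size_mul// sP.
(* Comparing sizes bounds that of the cofactor [q] by n + 1, which is what orthogonality to the
   Legendre polynomial of degree n + 1 asks for. *)
have := size_polyMleq (lagrange1 p i) (lagrange1 p j).
rewrite -sqP addnS /= => sq; rewrite -(leq_add2r n.+1) (leq_trans sq)//.
by rewrite (leq_trans (leq_pred _))// leq_add// size_lagrange1.

Qed.

(** * Interpolation and quadrature in several variables *)

Section HornerVariable.
Variables (K : comNzRingType) (m : nat).
Implicit Type q : {poly K}.

(** Substituting the i-th variable is an algebra morphism, so univariate identities transfer to [m]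
    variables and the Lagrange basis becomes a tensor product. *)
Definition horner_var (i : 'I_m) q : mpoly m K := horner_alg (mpolyX K (mnm1 i)) q.

Lemma meval_horner_var (v : 'I_m -> K) i q : meval v (horner_var i q) = q.[v i].
Proof.
rewrite /horner_var; elim/poly_ind: q => [|q c IHq].
  by rewrite rmorph0 meval0 horner0.
rewrite rmorphD rmorphM /= horner_algX horner_algC mevalD mevalM IHq mevalXU.
by rewrite mevalZ meval1 mulr1 !hornerE.
Qed.

Lemma horner_var_is_linear i : linear (horner_var i).
Proof.
move=> c q r; rewrite /horner_var rmorphD -mul_polyC rmorphM/= horner_algC.
by rewrite mulr_algl.
Qed.

HB.instance Definition _ i := GRing.isLinear.Build K {poly K} (mpoly m K) _
  (horner_var i) (horner_var_is_linear i).

Lemma horner_var_prod i (I : finType) (P : pred I) (c d : I -> K) :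
  horner_var i (\prod_(j | P j) (c j *: ('X - (d j)%:P))) =
  \prod_(j | P j) (c j *: (mpolyX K (mnm1 i) - mpolyC m (d j))).
Proof.
rewrite {1}/horner_var rmorph_prod; apply: eq_bigr => j _ /=.
rewrite -/(horner_var i _) linearZ/= /horner_var rmorphB/= horner_algX.
by rewrite horner_algC alg_mpolyC.
Qed.

Lemma horner_varXn i k : horner_var i 'X^k = mpolyX K (mnm1 i) ^+ k.
Proof. by rewrite /horner_var rmorphXn /= horner_algX. Qed.

End HornerVariable.

Section Interpolation.
Variables (R : realType) (m n : nat) (p : 'I_n.+1 -> R).
Hypothesis p_inj : injective p.
Local Notation A := {ffun 'I_m -> 'I_n.+1}.

Lemma lagrange_mpolyE (a : A) :
  lagrange_mpoly p a = \prod_i horner_var i (lagrange1 p (a i)).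
Proof. by apply: eq_bigr => i _; rewrite horner_var_prod. Qed.

Lemma meval_lagrange (v : 'I_m -> R) (a : A) :
  meval v (lagrange_mpoly p a) = \prod_i (lagrange1 p (a i)).[v i].
Proof.
rewrite lagrange_mpolyE rmorph_prod.
by apply: eq_bigr => i _; exact: meval_horner_var.
Qed.

Lemma meval_lagrange_node (a b : A) :
  meval (node p b) (lagrange_mpoly p a) = (a == b)%:R.
Proof.
rewrite meval_lagrange; case: eqVneq => [<-|ab].
  by apply: big1 => i _; rewrite lagrange1E// eqxx.
have [i abi] : exists i, a i != b i.
  apply/existsP; rewrite -negb_forall; apply: contra ab => /forallP ab.
  by apply/eqP/ffunP => i; exact/eqP.
by rewrite (bigD1 i)//= lagrange1E// (negPf abi) mul0r.
Qed.

(** A monomial is a product of univariate powers. Each power is interpolated in its own variable,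
    and distributing the product over the sums yields one term per choice function, that is, per
    multi-index in [A]. *)
Lemma mpolyX_interpolation (M : multinom m) : (forall i, M i <= n)%N ->
  mpolyX R M = \sum_(a : A) meval (node p a) (mpolyX R M) *: lagrange_mpoly p a.
Proof.
move=> Mn; rewrite {1}mpolyXE_id.
rewrite (eq_bigr (fun i => \sum_j p j ^+ M i *: horner_var i (lagrange1 p j))).
  rewrite bigA_distr_bigA; apply: eq_bigr => a _ /=.
  by rewrite scaler_prod mevalX lagrange_mpolyE.
move=> i _; rewrite -horner_varXn.
rewrite {1}(lagrange1_interpolation p_inj (_ : (size 'X^(M i) <= n.+1)%N)).
  rewrite raddf_sum; apply: eq_bigr => j _ /=.
  by rewrite linearZ/= hornerXn.
by rewrite size_polyXn ltnS.
Qed.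

Lemma maxpoly_interpolation (Q : maxpoly R m n) :
  maxpoly_val Q = \sum_(a : A) meval (node p a) Q *: lagrange_mpoly p a.
Proof.
case: Q => Q /= /deg_leP Qn; rewrite {1}[Q]mpolyE.
transitivity (\sum_(M <- msupp Q) \sum_(a : A)
    (mcoeff M Q * meval (node p a) (mpolyX R M)) *: lagrange_mpoly p a).
  rewrite big_seq [RHS]big_seq; apply: eq_bigr => M; rewrite mcoeff_msupp => QM.
  rewrite {1}mpolyX_interpolation => [|i]; last exact: Qn.
  by rewrite scaler_sumr; apply: eq_bigr => a _; rewrite scalerA.
rewrite exchange_big/=; apply: eq_bigr => a _; rewrite -scaler_suml.
by congr (_ *: _); rewrite mevalE; apply: eq_bigr => M _; rewrite mevalX.
Qed.

End Interpolation.

(** * Integrals of tensor products of polynomials over the cube *)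

Section IntegralCube.
Variables (R : realType) (m : nat).
Local Notation mu := (lebesgue_tuple R m).

Lemma measurable_cube : measurable (@cube R m).
Proof.
have -> : @cube R m = \bigcap_(i in [set: 'I_m])
    ((fun x : m.-tuple (measurableTypeR R) => tnth x i) @^-1` `]-1, 1[%classic).
  apply/seteqP; split=> x /= xc i; first by move=> _ /=; rewrite in_itv/= xc.
  by have := xc i I; rewrite /= in_itv.
apply: fin_bigcap_measurable => // i _; rewrite -[X in measurable X]setTI.
exact: measurable_tnth.
Qed.

Lemma integral_cube_tensor (q : 'I_m -> {poly R}) :
  mu.-integrable (@cube R m) (EFin \o fun x => \prod_i (q i).[tnth x i]) /\
  \int[mu]_(x in @cube R m) \prod_i (q i).[tnth x i] =
  \prod_i poly_integral (q i).
Proof.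
(* The indicator of the cube is the product of the indicators of ]-1, 1[, so the integrand extended
   by 0 is again a tensor product and [integral_tensor] applies on the whole space. *)
pose v i : measurableTypeR R -> R := horner (q i) \_ `]-1, 1[.
have vE : (fun x : m.-tuple (measurableTypeR R) => \prod_i (q i).[tnth x i]) \_
    (@cube R m) = fun x => \prod_i v i (tnth x i).
  apply/funext => x; rewrite /v !patchE; case: ifPn => [/set_mem xc|xc].
    apply: eq_bigr => i _; rewrite patchE mem_set//=.
    by rewrite in_itv; exact: xc.
  have [i xi] : exists i, ~ (-1 < (tnth x i : R) < 1).
    by apply/existsNP => xc'; move: xc; rewrite mem_set.
  rewrite (bigD1 i)//= patchE memNset ?mul0r//=.
have iv i : (@lebesgue_measure R).-integrable setT (EFin \o v i).
  rewrite /v -restrict_EFin.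
  by apply: (iffLR (integrable_mkcond _ _)) (integrable_poly (q i)).
have [vi ve] := integral_tensor iv; split.
  by apply: (integrable_mkcond _ measurable_cube).2; rewrite restrict_EFin vE.
rewrite Rintegral_mkcond vE /Rintegral ve /=.
by apply: eq_bigr => i _; rewrite /poly_integral Rintegral_mkcond.
Qed.

End IntegralCube.

Lemma Rintegral_sum d (T : measurableType d) (R : realType)
    (mu : {measure set T -> \bar R}) (D : set T) (I : finType) (f : I -> T -> R) :
  measurable D -> (forall i, mu.-integrable D (EFin \o f i)) ->
  \int[mu]_(x in D) (\sum_i f i x) = \sum_i \int[mu]_(x in D) f i x.
Proof.
move=> mD fi; rewrite /Rintegral.
under eq_integral do rewrite -sumEFin.
rewrite (integral_sum mD fi) (eq_bigr (fun i => (\int[mu]_(x in D) f i x)%:E)).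
  by rewrite sumEFin.
by move=> i _; rewrite fineK//; exact: (integrable_fin_num mD (fi i)).
Qed.

(** * The diagonal cubature formula for the L2 inner product *)

Section Quadrature.
Variables (R : realType) (m n : nat) (p : 'I_n.+1 -> R).
Hypothesis hp : legendre_grid p.
Local Notation A := {ffun 'I_m -> 'I_n.+1}.
Local Notation lagrange := (@Defs.lagrange R m n p).

Lemma integral_lagrangeM (a b : A) :
  (lebesgue_tuple R m).-integrable (@cube R m)
    (EFin \o fun x => maxpoly_fun (lagrange a) x * maxpoly_fun (lagrange b) x) /\
  ip (lagrange a) (lagrange b) =
  \prod_i poly_integral (lagrange1 p (a i) * lagrange1 p (b i)).
Proof.
rewrite /ip /L2ip.
have -> : (fun x => maxpoly_fun (lagrange a) x * maxpoly_fun (lagrange b) x) =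
    fun x => \prod_i (lagrange1 p (a i) * lagrange1 p (b i)).[tnth x i].
  apply/funext => x; rewrite /maxpoly_fun /= !meval_lagrange -big_split/=.
  by apply: eq_bigr => i _; rewrite hornerM.
exact: integral_cube_tensor.
Qed.

Lemma ip_lagrange (a b : A) : a != b -> ip (lagrange a) (lagrange b) = 0.
Proof.
move=> ab; have [i abi] : exists i, a i != b i.
  apply/existsP; rewrite -negb_forall; apply: contra ab => /forallP ab.
  by apply/eqP/ffunP => i; exact/eqP.
by rewrite (integral_lagrangeM a b).2 (bigD1 i)//= integral_lagrange1M// mul0r.
Qed.

Lemma ip_lagrange_gt0 (a : A) : 0 < ip (lagrange a) (lagrange a).
Proof.
rewrite (integral_lagrangeM a a).2 prodr_gt0// => i _.
by rewrite -expr2 poly_integral_sqr_gt0// lagrange1_neq0//; case: hp.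
Qed.

Lemma ipE (f g : maxpoly R m n) :
  ip f g = ((evalvec p f)^T *m W_mx m p *m evalvec p g) 0 0.
Proof.
have [p_inj _] := hp.
have fgE : (fun x => maxpoly_fun f x * maxpoly_fun g x) =
    fun x => \sum_(ab : A * A) (meval (node p ab.1) f * meval (node p ab.2) g) *
      (maxpoly_fun (lagrange ab.1) x * maxpoly_fun (lagrange ab.2) x).
  apply/funext => x; rewrite -(pair_bigA _ (fun a b : A =>
    (meval (node p a) f * meval (node p b) g) *
      (maxpoly_fun (lagrange a) x * maxpoly_fun (lagrange b) x)))/=.
  rewrite /maxpoly_fun (maxpoly_interpolation p_inj f).
  rewrite (maxpoly_interpolation p_inj g) !raddf_sum mulr_suml/=.
  apply: eq_bigr => a _; rewrite mulr_sumr; apply: eq_bigr => b _.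
  (* The expansion has also been substituted into the coefficients, where it is folded back into the
     values of [f] and [g] at the nodes. *)
  rewrite !mevalZ -!(maxpoly_interpolation p_inj); ring.
rewrite /ip /L2ip fgE Rintegral_sum; first last.
- move=> [a b]; have /(integrableZl (@measurable_cube R m)) := (integral_lagrangeM a b).1.
  by apply.
- exact: measurable_cube.
rewrite -(pair_bigA _ (fun a b : A => \int[lebesgue_tuple R m]_(x in @cube R m)
    (meval (node p a) f * meval (node p b) g *
      (maxpoly_fun (lagrange a) x * maxpoly_fun (lagrange b) x))))/=.
(* The matrix sum is reindexed by [A]; in the double integral only the diagonal terms survive. *)
rewrite mxE (reindex _ (onW_bij _ (enum_rank_bij A)))/=.
apply: eq_bigr => a _; rewrite (bigD1 a)//= big1 ?addr0 => [|b ba]; last first.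
  rewrite RintegralZl; [|exact: measurable_cube|exact: (integral_lagrangeM a b).1].
  by rewrite -[X in _ * X]/(ip _ _) ip_lagrange ?mulr0// eq_sym.
rewrite RintegralZl; [|exact: measurable_cube|exact: (integral_lagrangeM a a).1].
rewrite -[X in _ * X]/(ip _ _) mul_mx_diag !mxE enum_rankK.
by rewrite mulrAC.
Qed.

End Quadrature.

(** * Matrix representations *)

Section Gram.
Variables (R : realType) (N : nat).
Implicit Types M V : 'M[R]_N.

(** A singular matrix has a nonzero left kernel vector, at which the quadratic form would be 0. *)
Lemma posdef_unitmx M :
  (forall u : 'rV_N, u != 0 -> 0 < (u *m M *m u^T) 0 0) -> M \in unitmx.
Proof.
move=> M_gt0; rewrite unitmxE unitfE; apply/negP => /det0P[u u0 uM].
by have := M_gt0 u u0; rewrite uM mul0mx mxE ltxx.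
Qed.

Lemma diag_mx_quad (d : 'rV[R]_N) (u : 'rV_N) :
  (u *m diag_mx d *m u^T) 0 0 = \sum_i d 0 i * u 0 i ^+ 2.
Proof.
rewrite mxE; apply: eq_bigr => i _.
by rewrite mul_mx_diag !mxE mulrAC mulrC expr2.
Qed.

Lemma gram_sum_unitmx (I : finType) (i0 : I) (d : 'rV[R]_N) (E : I -> 'M[R]_N) :
  (forall i, 0 < d 0 i) -> E i0 = 1%:M ->
  \sum_i E i *m diag_mx d *m (E i)^T \in unitmx.
Proof.
move=> d0 E1; apply: posdef_unitmx => u u0.
have V0 (v : 'rV_N) : 0 <= (v *m diag_mx d *m v^T) 0 0.
  by rewrite diag_mx_quad sumr_ge0// => i _; rewrite mulr_ge0 ?sqr_ge0// ltW.
rewrite mulmx_sumr mulmx_suml summxE (bigD1 i0)//= ltr_wpDr//.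
  apply: sumr_ge0 => i _; have := V0 (u *m E i).
  by rewrite trmx_mul !mulmxA.
rewrite E1 mul1mx trmx1 mulmx1 diag_mx_quad.
have [i ui] : exists i, u 0 i != 0.
  by apply/rV0Pn.
rewrite (bigD1 i)//= ltr_wpDr ?sumr_ge0// => [j _|].
  by rewrite mulr_ge0 ?sqr_ge0// ltW.
by rewrite mulr_gt0// exprn_even_gt0.
Qed.

(** With [J] the inverse of [S], this collapses the form of [W *m S] evaluated at [J f] and [J g] to
    the matrix of negative order. By symmetry W S = S^T W, so the transposed inverse cancels S^T. *)
Lemma invmx_congr_sym (W S : 'M[R]_N) : S \in unitmx -> (W *m S)^T = W *m S ->
  W^T = W -> (invmx S)^T *m (W *m S) *m invmx S = W *m invmx S.
Proof.
move=> uS WS WT; rewrite -{1}WS trmx_mul mulmxA -trmx_mul mulmxV// trmx1 mul1mx.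
by rewrite WT.
Qed.

End Gram.

(** * Operators and inner products on evaluation vectors *)

Section Representation.
Variables (R : realType) (m n : nat) (p : 'I_n.+1 -> R).
Hypothesis hp : legendre_grid p.
Local Notation A := {ffun 'I_m -> 'I_n.+1}.
Local Notation lagrange := (@Defs.lagrange R m n p).
Local Notation ev := (@evalvec R m n p).
Local Notation W := (W_mx m p).
Local Notation D := (@D_mx R m n p).
Local Notation Dstar := (@Dstar_mx R m n p).
Implicit Types f g : maxpoly R m n.

Let p_inj : injective p. Proof. by case: hp. Qed.

Lemma evalvec_is_linear : linear ev.
Proof. by move=> c f g; apply/colP => i; rewrite !mxE mevalD mevalZ. Qed.

HB.instance Definition _ := GRing.isLinear.Build R (maxpoly R m n)
  'cV[R]_#|A| _ ev evalvec_is_linear.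

Lemma evalvec_lagrange i : ev (lagrange (enum_val i)) = delta_mx i 0.
Proof.
apply/colP => j; rewrite !mxE meval_lagrange_node// eqxx andbT.
by rewrite (inj_eq enum_val_inj) eq_sym.
Qed.

Lemma evalvec_mx_op (M : 'M[R]_#|A|) f : ev (mx_op p M f) = M *m ev f.
Proof.
rewrite linear_sum/=; apply/colP => i; rewrite summxE (bigD1 i)//= big1 => [|j ji].
  by rewrite addr0 linearZ/= evalvec_lagrange !mxE !eqxx mulr1.
by rewrite linearZ/= evalvec_lagrange !mxE eq_sym (negPf ji) mulr0.
Qed.

Lemma mx_op_is_linear (M : 'M[R]_#|A|) : linear (mx_op p M).
Proof.
move=> c f g; rewrite /mx_op scaler_sumr -big_split; apply: eq_bigr => i _ /=.
by rewrite linearP mulmxDr -scalemxAr scalerA -scalerDl !mxE.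
Qed.

(** Unlike [evalvec], this takes bare polynomials, as produced by the intermediate steps of an
    iterated derivative. *)
Let evm (P : mpoly m R) : 'cV[R]_#|A| := \col_a meval (node p (enum_val a)) P.

Lemma evalvec_mderiv i (P : mpoly m R) : P \in deg_le (fun=> n) ->
  evm (mderiv i P) = D1_mx p i *m evm P.
Proof.
move=> Pn; apply/colP => a; rewrite !mxE.
have /= PE := maxpoly_interpolation p_inj (MaxPoly Pn); rewrite {1}PE.
rewrite (linear_sum (mderiv i)) (raddf_sum (meval _))/=.
rewrite (reindex _ (onW_bij _ (enum_val_bij A)))/=.
by apply: eq_bigr => b _; rewrite !mxE mderivZ mevalZ mulrC.
Qed.

Lemma evalvec_D_op b f : ev (D_op b f) = D b *m ev f.
Proof.
rewrite /D_mx [index_enum _]unlock -enumT.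
(* [mderivm] composes the derivatives in the order of the enumeration, as the matrix product does,
   so no matrices have to be commuted. The degree bound is carried along because [evalvec_mderiv]
   requires it at each step. *)
suff [] : (mderivm b f \in deg_le (fun=> n)) /\ evm (mderivm b f) =
    (\prod_(i <- enum 'I_m) D1_mx p i ^+ b i) *m ev f by [].
rewrite /mderivm; elim: (enum _) => [|i s [sn IHs]] /=.
  by rewrite big_nil mul1mx; split=> //; exact: valP f.
rewrite big_cons -[X in X *m _]/(_ *m _) -mulmxA -{}IHs.
elim: (b i) => [|l [ln IHl]] /=; first by rewrite mul1mx.
split; first exact: deg_le_deriv.
by rewrite evalvec_mderiv// IHl exprS -[X in _ = X *m _]/(_ *m _) mulmxA.
Qed.

Lemma W_mx_gt0 (i : 'I_#|A|) :
  0 < (\row_a ip (lagrange (enum_val a)) (lagrange (enum_val a))) 0 i.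
Proof. by rewrite mxE ip_lagrange_gt0. Qed.

Lemma W_mx_unit : W \in unitmx.
Proof.
rewrite unitmxE det_diag unitfE gt_eqF// prodr_gt0// => i _; exact: W_mx_gt0.
Qed.

Lemma invmx_W_mx :
  invmx W = diag_mx (\row_(a < #|A|) (ip (lagrange (enum_val a)) (lagrange (enum_val a)))^-1).
Proof.
rewrite -[RHS]mulmx1 -(mulmxV W_mx_unit) mulmxA mulmx_diag.
rewrite (_ : diag_mx _ = 1%:M) ?mul1mx// -diag_const_mx; congr diag_mx.
by apply/rowP => a; rewrite !mxE mulVf// gt_eqF// ip_lagrange_gt0.
Qed.

Lemma trmx_W_mx : W^T = W.
Proof. exact: tr_diag_mx. Qed.

(** Testing against the Lagrange polynomials yields the entries of [W] times the evaluation vector;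
    [W] is invertible, and interpolation recovers the polynomial. Uniqueness of adjoints and of
    representers rests on this. *)
Lemma ip_inj g g' : (forall f, ip f g = ip f g') -> g = g'.
Proof.
move=> gg'; have : ev g = ev g'.
  rewrite -[LHS](mulKmx W_mx_unit) -[RHS](mulKmx W_mx_unit); congr (_ *m _).
  apply/colP => i; have := gg' (lagrange (enum_val i)).
  by rewrite !(ipE hp) evalvec_lagrange trmx_delta -!mulmxA -!rowE !mxE.
move=> evgg'; apply/val_inj => /=.
rewrite (maxpoly_interpolation p_inj g) (maxpoly_interpolation p_inj g').
apply: eq_bigr => a _; congr (_ *: _).
by have /colP/(_ (enum_rank a)) := evgg'; rewrite !mxE enum_rankK.
Qed.

Lemma is_adjoint_Dstar_mx (b : multinom m) : is_adjoint (D_op b) (mx_op p (Dstar b)).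
Proof.
split; first exact: mx_op_is_linear.
move=> f g; rewrite !(ipE hp) evalvec_D_op evalvec_mx_op trmx_mul /Dstar_mx.
by rewrite !mulmxA mulmxK ?W_mx_unit.
Qed.

Lemma evalvec_Dstar_op b f : ev (Dstar_op b f) = Dstar b *m ev f.
Proof.
rewrite -evalvec_mx_op; congr ev; rewrite /Dstar_op /adjoint.
(* The default value of [adjoint] is excluded because the matrix provides an adjoint; by
   nondegeneracy the chosen one agrees with it. *)
case: pselect => [h|]; last first.
  by case; exists (mx_op p (Dstar b)); exact: is_adjoint_Dstar_mx.
case: (cid h) => S [_ hS] /=; apply: ip_inj => g.
by rewrite -hS (is_adjoint_Dstar_mx b).2.
Qed.

(** Since [f] is a candidate, [xget] does not fall back to 0. Any polynomial with the same
    functional has the same inner products with the whole space, hence equals [f]. *)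
Lemma representer_dual f : representer n (dual f) = f.
Proof.
apply: ip_inj => g; rewrite /representer; case: xgetP => [g' _ /= fg'|/(_ f) []//].
have ipC (u v : maxpoly R m n) : ip u v = ip v u.
  by apply: eq_Rintegral => x _; rewrite mulrC.
by rewrite ipC [RHS]ipC; exact/esym/(congr1 (@^~ (maxpoly_fun g)) fg').
Qed.

Variable k : nat.

Lemma D_mx0 : D (@mnm0 m) = 1%:M.
Proof. by rewrite /D_mx big1// => i _; rewrite mnm0E expr0. Qed.

Lemma sum_DstarD : \sum_(b : bmultinom m k.+1) Dstar b *m D b =
  invmx W *m \sum_(b : bmultinom m k.+1) (D b)^T *m W *m D b.
Proof. by rewrite mulmx_sumr; apply: eq_bigr => b _; rewrite !mulmxA. Qed.

Lemma sum_DDstar : \sum_(b : bmultinom m k.+1) D b *m Dstar b =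
  (\sum_(b : bmultinom m k.+1) D b *m invmx W *m (D b)^T) *m W.
Proof. by rewrite mulmx_suml; apply: eq_bigr => b _; rewrite !mulmxA. Qed.

(** The zero multi-index lies in the sum for every [k] and supplies the positive definite term. *)
Let b0 : bmultinom m k.+1.
Proof. by exists (@mnm0 m); rewrite mdeg0. Defined.

Lemma sum_DstarD_unit : \sum_(b : bmultinom m k.+1) Dstar b *m D b \in unitmx.
Proof.
rewrite sum_DstarD unitmx_mul unitmx_inv W_mx_unit/=.
(* The summand is put in Gram form with the transpose of [D b] as left factor. *)
under eq_bigr => b _ do rewrite -[X in _ *m X]trmxK.
apply: (@gram_sum_unitmx _ _ _ b0) => [|]; first exact: W_mx_gt0.
by rewrite D_mx0 trmx1.
Qed.

Lemma sum_DDstar_unit : \sum_(b : bmultinom m k.+1) D b *m Dstar b \in unitmx.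
Proof.
rewrite sum_DDstar unitmx_mul W_mx_unit andbT invmx_W_mx.
apply: (@gram_sum_unitmx _ _ _ b0) => [i|]; last exact: D_mx0.
by rewrite mxE invr_gt0 ip_lagrange_gt0.
Qed.

Lemma sobolev_ipE f g : sobolev_ip k f g =
  ((ev f)^T *m (W *m \sum_(b : bmultinom m k.+1) Dstar b *m D b) *m ev g) 0 0.
Proof.
rewrite sum_DstarD mulKVmx ?W_mx_unit// mulmx_sumr mulmx_suml summxE.
by apply: eq_bigr => b _; rewrite (ipE hp) !evalvec_D_op trmx_mul !mulmxA.
Qed.

Lemma sobolev_star_ipE f g : sobolev_star_ip k f g =
  ((ev f)^T *m (W *m \sum_(b : bmultinom m k.+1) D b *m Dstar b) *m ev g) 0 0.
Proof.
rewrite !mulmx_sumr mulmx_suml summxE; apply: eq_bigr => b _.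
rewrite (ipE hp) !evalvec_Dstar_op trmx_mul /Dstar_mx !trmx_mul trmxK.
rewrite trmx_inv trmx_W_mx.
by rewrite !mulmxA (mulmxKV W_mx_unit).
Qed.

Lemma trmx_W_sum_DstarD :
  (W *m \sum_(b : bmultinom m k.+1) Dstar b *m D b)^T =
  W *m \sum_(b : bmultinom m k.+1) Dstar b *m D b.
Proof.
rewrite sum_DstarD mulKVmx ?W_mx_unit// linear_sum; apply: eq_bigr => b _ /=.
by rewrite !trmx_mul trmxK trmx_W_mx mulmxA.
Qed.

Lemma trmx_W_sum_DDstar :
  (W *m \sum_(b : bmultinom m k.+1) D b *m Dstar b)^T =
  W *m \sum_(b : bmultinom m k.+1) D b *m Dstar b.
Proof.
rewrite mulmx_sumr linear_sum; apply: eq_bigr => b _ /=.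
by rewrite /Dstar_mx !trmx_mul trmxK trmx_inv trmx_W_mx !mulmxA.
Qed.

End Representation.

(** * Exactness of the four cubature formulas *)

Theorem theorem10 (R : realType) (m n k : nat) (m_gt0 : (0 < m)%N)
    (p : 'I_n.+1 -> R) (hp : legendre_grid p) (f g : maxpoly R m n) :
  let ff := evalvec p f in
  let gg := evalvec p g in
  let F := dual f in
  let G := dual g in
  [/\ sobolev_ip k f g = (ff^T *m W_pos m p k *m gg) 0 0,
      sobolev_star_ip k f g = (ff^T *m Wunder_pos m p k *m gg) 0 0,
      neg_sobolev_ip p k F G = (ff^T *m W_neg m p k *m gg) 0 0
    & neg_sobolev_star_ip p k F G = (ff^T *m Wunder_neg m p k *m gg) 0 0].
Proof.
move=> ff gg F G; split.
- by rewrite (sobolev_ipE hp) /W_pos /J_mx invmxK.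
- by rewrite (sobolev_star_ipE hp) /Wunder_pos /Junder_mx invmxK.
(* The inner product of negative order is the positive one evaluated at [J f] and [J g]; the two
   factors [J] and the matrix W J^-1 between them collapse to W J. *)
- rewrite /neg_sobolev_ip !(representer_dual hp) -/(sobolev_ip k _ _).
  rewrite (sobolev_ipE hp) /J_op !evalvec_mx_op// trmx_mul.
  rewrite /W_neg -(invmx_congr_sym (sum_DstarD_unit m hp k))
    ?trmx_W_sum_DstarD ?trmx_W_mx//.
  by rewrite !mulmxA.
- rewrite /neg_sobolev_star_ip !(representer_dual hp) -/(sobolev_star_ip k _ _).
  rewrite (sobolev_star_ipE hp) /Junder_op !evalvec_mx_op// trmx_mul.
  rewrite /Wunder_neg -(invmx_congr_sym (sum_DDstar_unit m hp k))
    ?trmx_W_sum_DDstar ?trmx_W_mx//.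
  by rewrite !mulmxA.
Qed.
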